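(* For every non-negative integer $n$ and every positive integer $m$, the integer \[ S(2n,m)=\sum_{k=0}^{2n}(-1)^k\binom{2n}{k}^m C(2n,k)\, C(2n,2n-k) \] is divisible by the central binomial coefficient $\binom{2n}{n}$.
   Context: For integers $0\le k\le N$, $C(N,k)=\frac{N-k+1}{N+1}\binom{N+k}{N}$ (the Catalan triangle: the number of lattice paths from $(0,0)$ to $(N,k)$ with steps $(1,0)$ and $(0,1)$ never rising above $y=x$). *)

(* Defs.v *)
From mathcomp Require Import all_boot all_order all_algebra.

Set Implicit Arguments.
Unset Strict Implicit.
Unset Printing Implicit Defensive.

Import GRing.Theory Num.Theory.

(* Intended for k <= N, where [N - k] is not truncated; the quotient is then
   exact, see [catalan_triangle_exact]. *)
Definition catalan_triangle (N k : nat) : nat :=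
  ((N - k + 1) * 'C(N + k, N)) %/ (N + 1).

Lemma catalan_triangle_exact (N k : nat) : k <= N ->
  catalan_triangle N k * (N + 1) = (N - k + 1) * 'C(N + k, N).
Proof.
move=> le_kN; apply: divnK.
have -> : (N - k + 1) * 'C(N + k, N)
          = (N + 1) * ('C(N + k, N) - 'C(N + k, N.+1)).
  rewrite mulnBr addn1 (addn1 N) mul_bin_left addKn.
  by rewrite -mulnBl subSn.
exact: dvdn_mulr.
Qed.

Local Open Scope ring_scope.

Definition catalan_sum (N m : nat) : int :=
  \sum_(0 <= k < N.+1)
    (-1) ^+ k * ('C(N, k)%:Z) ^+ m
      * (catalan_triangle N k)%:Z * (catalan_triangle N (N - k)%N)%:Z.

(* Main.v *)
Require Import Defs.
From mathcomp Require Import all_boot all_order all_algebra.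
From mathcomp Require Import ring zify.

Set Implicit Arguments.
Unset Strict Implicit.
Unset Printing Implicit Defensive.

Import GRing.Theory Num.Theory.

(** Write [N = 2n] and [e_j k = 'C(k, j) * 'C(N - k, j)], and let [W f] be the
    alternating sum of [(-1) ^ k * 'C(N, k) * f k * F k], where [F k] is the
    product of the two Catalan triangle entries. By Vandermonde,
    ['C(N, k) * e_j k] is an integral combination of the [e_l k], so once
    ['C(2n, n)] divides every [W e_j], it also divides every
    [W (e_j * 'C(N, .) ^ t)]; the theorem is [j = 0], [t = m - 1].

    For [F_p k = 'C(p + k, p) * 'C(p + N - k, p)] in place of [F] the sum has a
    closed form (the terminating case of Dixon's theorem), obtained by induction
    on [p] from the fact that [k * (N - k)] maps [e_j] into the span of [e_j] and
    [e_(j+1)]; it is a multiple of ['C(2n, n)]. Finally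
    [(N + 1) * F = (N + 1) * F_(N+1) - 2 * N * F_N], and the factor [N + 1] can be
    cancelled because it divides the cofactor of ['C(2n, n)] for [p = N]. *)

(** * Identities between products of binomial coefficients *)

Definition symbin (N j k : nat) : nat := 'C(k, j) * 'C(N - k, j).

Lemma mul_bin_bin (n k j : nat) : j <= k -> k <= n ->
  'C(n, k) * 'C(k, j) = 'C(n, j) * 'C(n - j, k - j).
Proof.
move=> le_jk le_kn; have le_jn := leq_trans le_jk le_kn.
have f_gt0 : 0 < j`! * (k - j)`! * (n - k)`! by rewrite !muln_gt0 !fact_gt0.
apply/eqP; rewrite -(eqn_pmul2r f_gt0); apply/eqP.
have := bin_fact (leq_sub2r j le_kn); rewrite -subnDA subnKC // => e4.
transitivity n`!.
  by rewrite -(bin_fact le_kn) -(bin_fact le_jk); ring.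
by rewrite -(bin_fact le_jn) -e4; ring.
Qed.

(** Both sides count the pairs of disjoint subsets of sizes [i] and [j] in an [n]-set. *)
Lemma mul_bin_compl (n i j : nat) :
  'C(n, i) * 'C(n - i, j) = 'C(n, j) * 'C(n - j, i).
Proof.
case: (leqP (i + j) n) => [le_ijn | lt_nij]; last first.
  have z a b : n < a + b -> 'C(n, a) * 'C(n - a, b) = 0.
    case: (leqP a n) => [le_an | /bin_small -> //] lt_nab.
    by rewrite [X in _ * X]bin_small ?muln0 // ltn_subLR.
  by rewrite !z // addnC.
have le_jn : j <= n - i by lia.
have le_in : i <= n by lia.
have le_in' : n - i <= n by lia.
rewrite -[in LHS](bin_sub le_in) mul_bin_bin //; congr (_ * _).
by rewrite -(@bin_sub (n - j) i); [congr 'C(_, _) |]; lia.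
Qed.

(** Since ['C(N, k) * 'C(N - k, j) = 'C(N, j) * 'C(N - j, k)], it suffices to expand
    ['C(k, j) * 'C(N - j, k)]: split [N - j] as [(N - k) + (k - j)] and apply Vandermonde. *)
Lemma bin_symbin (N j k : nat) : k <= N ->
  'C(N, k) * symbin N j k = 'C(N, j) * \sum_(l < N.+1) 'C(l, j) * symbin N l k.
Proof.
move=> le_kN; rewrite /symbin.
have [le_jk | lt_kj] := leqP j k; last first.
  rewrite (bin_small lt_kj) mul0n muln0 big1 ?muln0 // => l _.
  case: (ltnP l j) => [/bin_small -> // | le_jl].
  by rewrite (@bin_small k l) ?mul0n ?muln0 //; apply: leq_trans le_jl.
have -> : \sum_(l < N.+1) 'C(l, j) * ('C(k, l) * 'C(N - k, l))
          = 'C(k, j) * 'C(N - j, k).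
  have -> : N - j = N - k + (k - j) by lia.
  rewrite -binomial.Vandermonde big_distrr /= (big_ord_widen_cond N.+1 xpredT
    (fun i => 'C(k, j) * ('C(N - k, i) * 'C(k - j, k - i)))) //=.
  rewrite [RHS]big_mkcond /=; apply: eq_bigr => l _; rewrite ltnS.
  have [le_lk | lt_kl] := leqP l k; last by rewrite (bin_small lt_kl) muln0.
  have [le_jl | lt_lj] := leqP j l; last first.
    by rewrite (bin_small lt_lj) (@bin_small (k - j)) ?muln0 //; lia.
  have := mul_bin_bin le_jl le_lk.
  have -> : 'C(k - j, l - j) = 'C(k - j, k - l).
    by rewrite -bin_sub; [congr 'C(_, _) |]; lia.
  by move=> e; rewrite mulnA (mulnC _ 'C(k, l)) e; ring.
by rewrite mulnCA (mulnCA 'C(N, j)) mul_bin_compl; ring.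
Qed.

(** * Alternating sums and the reduction to a single binomial factor *)

Local Open Scope ring_scope.

Definition altsum (N : nat) (f : nat -> int) : int :=
  \sum_(k < N.+1) (-1) ^+ k * ('C(N, k))%:Z * f k.

Lemma eq_altsum (N : nat) (f g : nat -> int) :
  (forall k, (k <= N)%N -> f k = g k) -> altsum N f = altsum N g.
Proof.
by move=> eqfg; apply: eq_bigr => k _; rewrite eqfg // -ltnS ltn_ord.
Qed.

Lemma altsumD (N : nat) (f g : nat -> int) :
  altsum N (fun k => f k + g k) = altsum N f + altsum N g.
Proof.
by rewrite /altsum -big_split; apply: eq_bigr => k _; rewrite mulrDr.
Qed.

Lemma altsumZ (N : nat) (c : int) (f : nat -> int) :
  altsum N (fun k => c * f k) = c * altsum N f.
Proof. by rewrite /altsum big_distrr; apply: eq_bigr => k _; apply: mulrCA. Qed.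

(** [bin_symbin] trades one factor ['C(N, k)] for integer coefficients free of [k] but involves
    every [symbin N l], so the induction on [t] carries all [j] at once. *)
Lemma dvdz_altsum_bin_exp (N : nat) (d : int) (F : nat -> int) :
  (forall j, (d %| altsum N (fun k => (symbin N j k)%:Z * F k))%Z) ->
  forall t j,
    (d %| altsum N (fun k => ('C(N, k))%:Z ^+ t * (symbin N j k)%:Z * F k))%Z.
Proof.
move=> dF; elim=> [|t IHt] j.
  by under [altsum _ _]eq_altsum do rewrite expr0 mul1r; apply: dF.
have -> : altsum N (fun k => ('C(N, k))%:Z ^+ t.+1 * (symbin N j k)%:Z * F k)
  = ('C(N, j))%:Z * \sum_(l < N.+1) ('C(l, j))%:Z *
      altsum N (fun k => ('C(N, k))%:Z ^+ t * (symbin N l k)%:Z * F k).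
  under eq_bigr do rewrite -altsumZ.
  rewrite exchange_big big_distrr /=; apply: eq_bigr => k _.
  have le_kN : (k <= N)%N by rewrite -ltnS.
  have /(congr1 Posz) := bin_symbin j le_kN.
  rewrite [LHS]PoszM [RHS]PoszM (big_morph _ PoszD (erefl _)) => e.
  transitivity ((-1) ^+ k * ('C(N, k))%:Z * (('C(N, k))%:Z ^+ t * F k)
                * (('C(N, k))%:Z * (symbin N j k)%:Z)); first by rewrite exprSr; ring.
  rewrite e mulrCA; congr (_ * _); rewrite big_distrr /=; apply: eq_bigr => l _.
  by rewrite PoszM; ring.
by apply/dvdz_mull; apply: rpred_sum => l _; apply: dvdz_mull; apply: IHt.
Qed.

(** * Dixon's sum: recurrence, initial values, closed form, cofactor *)

Definition binpair (p N k : nat) : nat := ('C(p + k, p) * 'C(p + (N - k), p))%N.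

Lemma mulS_bin_add (p k : nat) :
  (p.+1 * 'C(p.+1 + k, p.+1) = (p.+1 + k) * 'C(p + k, p))%N.
Proof. by rewrite addSn -mul_bin_diag. Qed.

Lemma symbinS (N j k : nat) : (k <= N)%N ->
  (j.+1%:Z ^+ 2 * (symbin N j.+1 k)%:Z
   = (k%:Z - j%:Z) * (N%:Z - k%:Z - j%:Z) * (symbin N j k)%:Z).
Proof.
move=> le_kN; rewrite /symbin !PoszM.
have step m : j.+1%:Z * ('C(m, j.+1))%:Z = (m%:Z - j%:Z) * ('C(m, j))%:Z.
  have [le_jm | lt_mj] := leqP j m; first by rewrite subzn // -!PoszM mul_bin_left.
  by rewrite !bin_small ?mulr0 // ltnW.
transitivity ((j.+1%:Z * ('C(k, j.+1))%:Z) * (j.+1%:Z * ('C(N - k, j.+1))%:Z)).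
  by ring.
by rewrite !step -subzn //; ring.
Qed.

Lemma binpairS (p N k : nat) : (k <= N)%N ->
  (p.+1%:Z ^+ 2 * (binpair p.+1 N k)%:Z
   = (p.+1%:Z + k%:Z) * (p.+1%:Z + (N%:Z - k%:Z)) * (binpair p N k)%:Z).
Proof.
move=> le_kN; rewrite /binpair.
transitivity (((p.+1 * 'C(p.+1 + k, p.+1)) * (p.+1 * 'C(p.+1 + (N - k), p.+1)))%N%:Z).
  by rewrite !PoszM; ring.
by rewrite !mulS_bin_add !PoszM !PoszD -subzn //; ring.
Qed.

Definition dixon (p N j : nat) : int :=
  altsum N (fun k => (symbin N j k)%:Z * (binpair p N k)%:Z).

(** The quadratic factors in [binpairS] and [symbinS] are both [k * (N - k)] plus a constant; the
    constants differ by [(p + 1 + j) * (p + 1 + N - j)]. *)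
Lemma dixonS (p N j : nat) :
  p.+1%:Z ^+ 2 * dixon p.+1 N j
  = (p.+1%:Z + j%:Z) * (p.+1%:Z + (N%:Z - j%:Z)) * dixon p N j
    + j.+1%:Z ^+ 2 * dixon p N j.+1.
Proof.
rewrite /dixon -!altsumZ -altsumD; apply: eq_altsum => k le_kN.
rewrite mulrCA binpairS // [in RHS]mulrA [X in _ = _ + X]mulrA symbinS //.
by ring.
Qed.

Lemma alt_sum_bin (M L : nat) : (0 < M)%N -> (M < L)%N ->
  \sum_(v < L) (-1) ^+ v * ('C(M, v))%:Z = 0.
Proof.
move=> M_gt0 lt_ML.
have -> : \sum_(v < L) (-1) ^+ v * ('C(M, v))%:Z
          = \sum_(v < M.+1) (-1) ^+ v * ('C(M, v))%:Z.
  rewrite (big_ord_widen _ (fun v => (-1) ^+ v * ('C(M, v))%:Z) lt_ML) [RHS]big_mkcond.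
  by apply: eq_bigr => v _; rewrite ltnS; case: leqP => // /bin_small->; rewrite mulr0.
have := exprBn (1 : int) 1 M; rewrite subrr expr0n eqn0Ngt M_gt0 => e; rewrite [RHS]e.
apply: eq_bigr => v _; rewrite !expr1n !mulr1 -mulr_natr; congr (_ * _).
by rewrite natz.
Qed.

(** With [k = v + j], the product ['C(N, k) * symbin N j k] is a constant times ['C(N - 2j, v)], and
    the alternating sum of row [N - 2j > 0] is zero. *)
Lemma altsum_symbin_eq0 (N j : nat) : (j.*2 < N)%N ->
  altsum N (fun k => (symbin N j k)%:Z) = 0.
Proof.
move=> lt_j2N; have le_jN : (j <= N.+1)%N by lia.
rewrite /altsum -(big_mkord xpredT
  (fun k => (-1) ^+ k * ('C(N, k))%:Z * (symbin N j k)%:Z)).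
rewrite (big_cat_nat (leq0n j) le_jN) /= big_nat big1 ?add0r => [|k /andP[_ lt_kj]].
  rewrite -{1}(add0n j) big_addn big_mkord.
  rewrite (eq_bigr (fun v : 'I__ => ((-1) ^+ j * ('C(N, j) * 'C(N - j, j))%N%:Z)
            * ((-1) ^+ v * ('C(N - j - j, v))%:Z))) => [|[v lt_v] _ /=].
    by rewrite -big_distrr /= alt_sum_bin ?mulr0 //; lia.
  have e1 : ('C(N, v + j) * 'C(v + j, j) = 'C(N, j) * 'C(N - j, v))%N.
    by rewrite mul_bin_bin ?addnK ?leq_addl //; lia.
  have e2 := mul_bin_compl (N - j) v j.
  rewrite exprD /symbin -mulrA -PoszM mulnA e1.
  have -> : (N - (v + j) = N - j - v)%N by lia.
  by rewrite -mulnA e2 !PoszM; ring.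
by rewrite /symbin (bin_small lt_kj) mulr0.
Qed.

(** The factor ['C(n, j) * 'C(n, n.*2 - j)] is 1 at [j = n] and 0 elsewhere. For [j > n] every term
    vanishes, and for [j = n] only [k = n] survives. *)
Lemma dixon0 (n j : nat) :
  dixon 0 n.*2 j = (-1) ^+ n * ('C(n.*2, n) * ('C(n, j) * 'C(n, n.*2 - j)))%N%:Z.
Proof.
rewrite /dixon; under [altsum _ _]eq_altsum do rewrite /binpair !bin0 mulr1.
case: (ltngtP j n) => [lt_jn | lt_nj | ->].
- rewrite altsum_symbin_eq0 ?ltn_double // (@bin_small n (_ - _)) ?muln0 ?mulr0 //.
  by lia.
- rewrite (bin_small lt_nj) muln0 mulr0 /altsum big1 // => [[k lt_k] _] /=.
  rewrite /symbin; have [/bin_small -> | le_jk] := ltnP k j; first by rewrite mulr0.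
  by rewrite (@bin_small (_ - _)) ?muln0 ?mulr0 //; lia.
- have lt_n : (n < n.*2.+1)%N by lia.
  rewrite /altsum (bigD1 (Ordinal lt_n)) //= /symbin big1 => [|[k lt_k]] /=.
    by rewrite -addnn addnK !binn addr0 !muln1 [LHS]mulr1.
  move=> ne_kn; have := ne_kn.
  rewrite -val_eqE /= neq_ltn => /orP[/bin_small -> | lt_nk]; first by rewrite mulr0.
  by rewrite (@bin_small (_ - _)) ?muln0 ?mulr0 //; lia.
Qed.

(** The cofactor of ['C(2n, n)] in Dixon's sum, up to sign; at [j = 0] it is ['C(p + n, 2n)]. *)
Definition dixon_quot (p n j : nat) : nat :=
  ('C(n, j) * 'C(p + n, n.*2 - j) * 'C(p + j, j))%N.

(** This is the recurrence of [dixonS] at [N = 2n]. Absorption ([e1], [e2], [e3]) reduces it to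
    [e4], which is Pascal's rule combined with one more absorption. *)
Lemma dixon_quotS (p n j : nat) :
  p.+1%:Z ^+ 2 * (dixon_quot p.+1 n j)%:Z
  = (p.+1%:Z + j%:Z) * (p.+1%:Z + (n.*2%:Z - j%:Z)) * (dixon_quot p n j)%:Z
    + j.+1%:Z ^+ 2 * (dixon_quot p n j.+1)%:Z.
Proof.
rewrite /dixon_quot.
have [le_jn | lt_nj] := leqP j n; last first.
  by rewrite (bin_small lt_nj) (bin_small (leqW lt_nj)) !mul0n !mulr0 addr0.
have e1 : j.+1%:Z * ('C(n, j.+1))%:Z = (n%:Z - j%:Z) * ('C(n, j))%:Z.
  by rewrite subzn // -!PoszM mul_bin_left.
have e2 : j.+1%:Z * ('C(p + j.+1, j.+1))%:Z = (p.+1%:Z + j%:Z) * ('C(p + j, j))%:Z.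
  by rewrite -PoszD -!PoszM addnS -mul_bin_diag addSn.
have e3 : p.+1%:Z * ('C(p.+1 + j, j))%:Z = (p.+1%:Z + j%:Z) * ('C(p + j, j))%:Z.
  rewrite -PoszD -!PoszM; congr Posz.
  by have := mul_bin_down (p.+1 + j) j; rewrite addnK addSn /= => <-.
have e4 : p.+1%:Z * ('C(p.+1 + n, n.*2 - j))%:Z
   = (p.+1%:Z + (n.*2%:Z - j%:Z)) * ('C(p + n, n.*2 - j))%:Z
     + (n%:Z - j%:Z) * ('C(p + n, n.*2 - j.+1))%:Z.
  have [a0 | a_gt0] := posnP (n.*2 - j).
    (* Here [n.*2 - j.+1] truncates to 0, but its term has the coefficient [n - j = 0]. *)
    have [-> ->] : n = 0%N /\ j = 0%N by lia.
    by rewrite (double0) !sub0n !bin0 subrr mul0r; ring.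
  have -> : (n.*2 - j = (n.*2 - j.+1).+1)%N by lia.
  have := mul_bin_left (p + n) (n.*2 - j.+1).
  set a := (n.*2 - j.+1)%N; have ea : n.*2%:Z - j%:Z = a.+1%:Z by rewrite /a; lia.
  have [le_a | lt_a] := leqP a (p + n); last by rewrite addSn !bin_small //; lia.
  move/(congr1 Posz); rewrite !PoszM -subzn // => e.
  rewrite ea addSn binS [X in _ * X]PoszD mulrDl e.
  have -> : (p + n)%:Z - a%:Z = p.+1%:Z - n%:Z + j%:Z by move: ea; lia.
  by ring.
transitivity (('C(n, j))%:Z * (p.+1%:Z * ('C(p.+1 + n, n.*2 - j))%:Z)
   * (p.+1%:Z * ('C(p.+1 + j, j))%:Z)); first by rewrite !PoszM; ring.
transitivity ((p.+1%:Z + j%:Z) * (p.+1%:Z + (n.*2%:Z - j%:Z)) *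
    (('C(n, j))%:Z * ('C(p + n, n.*2 - j))%:Z * ('C(p + j, j))%:Z)
  + (j.+1%:Z * ('C(n, j.+1))%:Z) * ('C(p + n, n.*2 - j.+1))%:Z
     * (j.+1%:Z * ('C(p + j.+1, j.+1))%:Z)); last by rewrite !PoszM; ring.
by rewrite e1 e2 e3 e4; ring.
Qed.

Lemma dixonE (p n j : nat) :
  dixon p n.*2 j = (-1) ^+ n * ('C(n.*2, n))%:Z * (dixon_quot p n j)%:Z.
Proof.
elim: p j => [|p IHp] j.
  by rewrite dixon0 /dixon_quot !add0n binn muln1 PoszM mulrA.
have p_neq0 : p.+1%:Z ^+ 2 != 0 :> int by rewrite expf_neq0.
apply: (mulfI p_neq0); rewrite dixonS !IHp [RHS]mulrCA dixon_quotS.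
by ring.
Qed.

(** Let [q = 2n + 1] and [g = gcd(q, j)]: then [g] divides ['C(3n, 2n - j)] and [q / g] divides
    ['C(2n + j, j)]. *)
Lemma dvdn_dixon_quot (n j : nat) : (n.*2.+1 %| dixon_quot n.*2 n j)%N.
Proof.
have [le_jn | lt_nj] := leqP j n; last by rewrite /dixon_quot (bin_small lt_nj).
rewrite /dixon_quot -mulnA; apply: dvdn_mull.
set q := n.*2.+1; set g := gcdn q j.
have g_gt0 : (0 < g)%N by rewrite gcdn_gt0.
have qE : (q = g * (q %/ g))%N by rewrite mulnC divnK ?dvdn_gcdl.
rewrite [X in (X %| _)%N]qE; apply: dvdn_mul.
  (* [2 * (3n + 1) = 3 * (2n + 1) - 1] *)
  have cop : coprime g (n.*2 + n).+1.
    apply: coprime_dvdl (dvdn_gcdl q j) _; rewrite coprime_sym.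
    rewrite /coprime -dvdn1.
    set h := gcdn _ _; have h1 : (h %| (n.*2 + n).+1 * 2)%N by rewrite dvdn_mulr ?dvdn_gcdl.
    have h2 : (h %| q * 3)%N by rewrite dvdn_mulr ?dvdn_gcdr.
    have -> : (1 = q * 3 - (n.*2 + n).+1 * 2)%N by rewrite /q; lia.
    exact: dvdn_sub.
  rewrite -(Gauss_dvdr _ cop).
  have -> : ((n.*2 + n).+1 * 'C(n.*2 + n, n.*2 - j)
           = (q - j) * 'C((n.*2 + n).+1, (n.*2 - j).+1))%N.
    by rewrite (mul_bin_diag (n.*2 + n).+1) /q subSn //; lia.
  by apply: dvdn_mulr; apply: dvdn_sub; [apply: dvdn_gcdl | apply: dvdn_gcdr].
have cop : coprime (q %/ g) (j %/ g).
  rewrite /coprime -(eqn_pmul2l g_gt0) muln1 muln_gcdr ![(g * (_ %/ g))%N]mulnC.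
  by rewrite !divnK ?dvdn_gcdl ?dvdn_gcdr.
(* Multiplying by [j / g] and then by [g] reduces the goal to [q] dividing [j * 'C(2n + j, j)]. *)
rewrite -(Gauss_dvdr _ cop) -(dvdn_pmul2l g_gt0) -qE mulnA (mulnC g) divnK ?dvdn_gcdr //.
case: j {le_jn g g_gt0 qE cop} => // j.
by rewrite addnS mul_bin_left -addnS -addSnnS addnK dvdn_mulr.
Qed.

(** * From Dixon's sum to the Catalan triangle *)

Lemma catalan_pairE (N k : nat) : (k <= N)%N ->
  N.+1%:Z * ((catalan_triangle N k)%:Z * (catalan_triangle N (N - k))%:Z)
  = N.+1%:Z * (binpair N.+1 N k)%:Z - N.*2%:Z * (binpair N N k)%:Z.
Proof.
move=> le_kN; have N_neq0 : N.+1%:Z != 0 :> int by [].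
have cE i : (i <= N)%N -> N.+1%:Z * (catalan_triangle N i)%:Z
    = (N%:Z - i%:Z + 1) * ('C(N + i, N))%:Z.
  move=> le_iN; rewrite subzn // -PoszD -!PoszM -catalan_triangle_exact //.
  by rewrite mulnC addn1.
apply: (mulfI N_neq0); rewrite mulrBr !mulrA -expr2 binpairS //.
transitivity ((N.+1%:Z * (catalan_triangle N k)%:Z)
   * (N.+1%:Z * (catalan_triangle N (N - k))%:Z)); first by ring.
rewrite !cE ?leq_subr // /binpair PoszM -subzn // -addnn PoszD -addn1 PoszD.
(* The identity behind this is [(N + 1 - k) * (k + 1) = (N + 1 + k) * (2N + 1 - k) - 2N * (N +
   1)]. *)
by ring.
Qed.

Lemma dvdz_altsum_catalan (n j : nat) :
  (('C(n.*2, n))%:Z %| altsum n.*2 (fun k => (symbin n.*2 j k)%:Z *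
    ((catalan_triangle n.*2 k)%:Z * (catalan_triangle n.*2 (n.*2 - k))%:Z)))%Z.
Proof.
set W := altsum _ _; have N_neq0 : n.*2.+1%:Z != 0 :> int by [].
have eW : n.*2.+1%:Z * W
    = n.*2.+1%:Z * dixon n.*2.+1 n.*2 j - n.*2.*2%:Z * dixon n.*2 n.*2 j.
  rewrite /W /dixon -mulNr -!altsumZ -altsumD; apply: eq_altsum => k le_kN.
  by rewrite mulrCA catalan_pairE //; ring.
have [q eq] := dvdnP (dvdn_dixon_quot n j).
(* Dividing [eW] by [2n + 1] keeps the quotient integral, since [dixon_quot n.*2 n j] is
   [q * (2n + 1)]. *)
apply/dvdzP; exists ((-1) ^+ n * ((dixon_quot n.*2.+1 n j)%:Z - n.*2.*2%:Z * q%:Z)).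
by apply: (mulfI N_neq0); rewrite eW !dixonE eq PoszM; ring.
Qed.

Theorem theorem3 (n m : nat) (hm : (0 < m)%N) :
  ('C((2 * n)%N, n)%:Z %| catalan_sum (2 * n)%N m)%Z.
Proof.
rewrite mul2n /catalan_sum big_mkord.
have := dvdz_altsum_bin_exp (dvdz_altsum_catalan n) m.-1 0.
congr (_ %| _)%Z; apply: eq_bigr => k _.
(* One of the [m] factors ['C(N, k)] is the weight inside [altsum]. *)
by rewrite /symbin !bin0 -{2}(prednK hm) exprS; ring.
Qed.
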